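(* Let $D$ be a planar knotoid diagram. Then $u(c)=d(c)\,\mathrm{sgn}(c)$ for each crossing $c$ in $D$.
   Context: **Knotoid diagrams.** A planar knotoid diagram $D$ is a generic immersion $f:[0,1]\to\mathbb{R}^2$ (its only multiple points are finitely many transverse double points, called crossings, distinct from $f(0)$ and $f(1)$) with over/under information at each crossing; it is oriented from $f(0)$ (the leg) to $f(1)$ (the head). $C(D)$ is the set of crossings. The sign $\mathrm{sgn}(c)$ is $+1$ if (tangent of overstrand, tangent of understrand) is a positively oriented basis of $\mathbb{R}^2$, and $-1$ otherwise. **Coloring number.** The arcs of $D$ are the closures of the components of $D\setminus C(D)$. A Cheng coloring assigns an integer to each arc so that, travelling along $D$, at each passage through a crossing (over or under) the label increases by $1$ if the curve crosses the other strand from right to left (with respect to that other strand's orientation) and decreases by $1$ if from left to right. It is unique up to an additive constant. At a crossing $c$, let $a$ be the label of the incoming arc of the strand crossing the other one from right to left (its outgoing arc has label $a+1$), and $b$ the label of the outgoing arc of the other strand (its incoming arc has label $b+1$). The coloring number is $u(c)=a-b$. **Degree.** The Gauss diagram $G(D)$ is the interval $[0,1]$ drawn as a counterclockwise oriented arc of a circle (with a gap between head and leg), with one chord for each crossing $c$ (also denoted $c$) joining its two preimages and oriented from the over-preimage to the under-preimage. For a chord $c$, $r(c)$ (resp. $l(c)$) is the set of chords crossing $c$ and pointing to the right (resp. left) hand side of $c$. Let $r^{\pm}(c)$, $l^{\pm}(c)$ be the subsets of chords of sign $\pm1$. The degree is $d(c)=|r^+(c)|-|r^-(c)|-|l^+(c)|+|l^-(c)|$.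 *)

(* Defs.v *)
From HB Require Import structures.
From mathcomp Require Import all_boot all_order all_algebra.
From mathcomp Require Import finmap.
From mathcomp Require Import all_classical all_reals all_analysis.

Set Implicit Arguments.
Unset Strict Implicit.
Unset Printing Implicit Defensive.

Import Order.TTheory GRing.Theory Num.Theory.
Import numFieldNormedType.Exports.

Local Open Scope classical_set_scope.
Local Open Scope ring_scope.

Section Plane.
Variable R : realType.
Implicit Types (u v p q x : R * R) (f : R -> R * R).

Definition det2 u v : R := u.1 * v.2 - u.2 * v.1.

Definition positively_oriented u v : bool := 0 < det2 u v.

(* For the line through p and q, directed from p to q. *)
Definition left_of p q x : bool := positively_oriented (q - p) (x - p).
Definition right_of p q x : bool := positively_oriented (x - p) (q - p).

Definition segment p q : set (R * R) :=
  [set x | exists2 k : R, 0 <= k <= 1 & x = (1 - k) *: p + k *: q].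

(* The curve [0,1] -> R^2 is represented by a function on R of which only the
   germ along [0,1] matters: smoothness on [0,1] means smoothness on an open
   neighbourhood of [0,1]. *)
Definition immersion01 f : Prop :=
  (forall t : R, 0 <= t <= 1 ->
     \forall x \near t, forall n : nat, derivable (derive1n n f) x 1) /\
  (forall t : R, 0 <= t <= 1 -> derive1 f t != 0).

(* s and t are the two parameters of a self-intersection of f. *)
Definition double_point f (s t : R) : Prop :=
  [/\ 0 <= s <= 1, 0 <= t <= 1, s != t & f s = f t].

Definition multiple_points f : set (R * R) :=
  [set p | exists s t, double_point f s t /\ f s = p].

Definition generic_immersion f : Prop :=
  [/\ immersion01 f,
      finite_set (multiple_points f),
      (forall r s t, double_point f r s -> double_point f s t -> r = t),
      (forall s t, double_point f s t -> det2 (derive1 f s) (derive1 f t) != 0) &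
      ~ multiple_points f (f 0) /\ ~ multiple_points f (f 1)].

End Plane.

(* At a crossing c, [over_time c] and [under_time c] are the parameters of the
   overpass and of the underpass; their values elsewhere are irrelevant. *)
Record knotoid_diagram (R : realType) := KnotoidDiagram {
  curve :> R -> R * R;
  over_time : R * R -> R;
  under_time : R * R -> R;
  curve_generic : generic_immersion curve;
  over_under_timeP : forall c, multiple_points curve c ->
    double_point curve (over_time c) (under_time c) /\ curve (over_time c) = c
}.

Section Knotoid.
Variable R : realType.
Variable D : knotoid_diagram R.
Implicit Types (c e : R * R) (s t : R).

Definition crossings : set (R * R) := multiple_points D.

Definition image_curve : set (R * R) := [set D t | t in [set t : R | 0 <= t <= 1]].

Definition tangent t : R * R := derive1 D t.

Definition sgn c : int :=
  if positively_oriented (tangent (over_time D c)) (tangent (under_time D c))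
  then 1 else -1.

Definition arcs : set (set (R * R)) :=
  [set A | exists2 p, (image_curve `\` crossings) p &
     A = closure (connected_component (image_curve `\` crossings) p)].

(* The arc travelled just before, respectively just after, the
   parameter t. For t in ]0, 1[ it exists and is unique: components of
   image_curve `\` crossings are closed in it, so the closures of distinct
   components share no non-crossing point of the curve. *)
Definition incoming_arc t : set (R * R) :=
  xget set0 [set A | arcs A /\ \forall s \near t^'-, A (D s)].
Definition outgoing_arc t : set (R * R) :=
  xget set0 [set A | arcs A /\ \forall s \near t^'+, A (D s)].

(* At a double point with parameters s and t, the passage at t crosses the
   strand through s from its right to its left (resp. left to right). *)
Definition right_to_left s t : bool :=
  positively_oriented (tangent s) (tangent t).
Definition left_to_right s t : bool :=
  positively_oriented (tangent t) (tangent s).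

(* Only the values of L on arcs matter. *)
Definition cheng_coloring (L : set (R * R) -> int) : Prop :=
  forall s t, double_point D s t ->
    (right_to_left s t -> L (outgoing_arc t) = L (incoming_arc t) + 1) /\
    (left_to_right s t -> L (outgoing_arc t) = L (incoming_arc t) - 1).

(* The parameter of the strand crossing the other one from right to left at c,
   and the parameter of the other strand. *)
Definition rl_strand c : R :=
  if right_to_left (over_time D c) (under_time D c)
  then under_time D c else over_time D c.
Definition lr_strand c : R :=
  if right_to_left (over_time D c) (under_time D c)
  then over_time D c else under_time D c.

Definition coloring_number (L : set (R * R) -> int) c : int :=
  L (incoming_arc (rl_strand c)) - L (outgoing_arc (lr_strand c)).

(* Gauss diagram: [0,1] is drawn as the upper unit half-circle, which
   t |-> (cos (pi t), sin (pi t)) runs through counterclockwise. *)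
Definition gauss_point t : R * R := (cos (pi * t), sin (pi * t)).

Definition chord_tail c : R * R := gauss_point (over_time D c).
Definition chord_head c : R * R := gauss_point (under_time D c).

Definition chord c : set (R * R) := segment (chord_tail c) (chord_head c).

Definition chords_cross c e : Prop := e <> c /\ chord c `&` chord e !=set0.

Definition rset c : set (R * R) :=
  [set e | [/\ crossings e, chords_cross c e &
               right_of (chord_tail c) (chord_head c) (chord_head e)]].
Definition lset c : set (R * R) :=
  [set e | [/\ crossings e, chords_cross c e &
               left_of (chord_tail c) (chord_head c) (chord_head e)]].

Definition of_sign (e : int) (A : set (R * R)) : set (R * R) :=
  A `&` [set c | sgn c = e].

(* The cardinal, for finite sets. *)
Definition cardz (A : set (R * R)) : int := Posz #|` fset_set A|%fset.

Definition degree c : int :=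
  cardz (of_sign 1 (rset c)) - cardz (of_sign (-1) (rset c))
  - cardz (of_sign 1 (lset c)) + cardz (of_sign (-1) (lset c)).

End Knotoid.

(* Main.v *)
Require Import Defs.
From mathcomp Require Import all_boot all_order all_algebra.
From mathcomp Require Import finmap.
From mathcomp Require Import all_classical all_reals all_analysis.
From mathcomp Require Import ring lra zify.

(* Between its two passages through c, the curve changes label by the sum of the
   jumps at the passages in between; with the jump of +-1 at each passage of c
   itself, this gives u(c) up to sign. The jump of L at the underpass of a
   crossing e is sgn e and at its overpass - sgn e, so crossings passed twice in
   between cancel, and the others are exactly the chords e crossing c. On the
   half-circle, the points between the ends of c lie to the right of c when the
   overpass of c comes first, and to its left otherwise, so the remaining jumps
   add up to +-d(c). *)

Set Implicit Arguments.
Unset Strict Implicit.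
Unset Printing Implicit Defensive.

Import Order.TTheory GRing.Theory Num.Theory.
Import numFieldNormedType.Exports.

Local Open Scope classical_set_scope.
Local Open Scope ring_scope.

(** * Orientation of triples of points and meeting of segments in the plane *)

(** Twice the signed area of the triangle [p q r], positive when [r] lies to the left of the line
    from [p] to [q]. *)
Definition orient (R : realType) (p q r : R * R) : R := det2 (q - p) (r - p).

Lemma orient_rot (R : realType) (p q r : R * R) : orient p q r = orient q r p.
Proof. rewrite /orient /det2 /=; ring. Qed.

Lemma orient_swap (R : realType) (p q r : R * R) :
  orient q p r = - orient p q r.
Proof. rewrite /orient /det2 /=; ring. Qed.

Lemma det2_swap (R : realType) (u v : R * R) : det2 v u = - det2 u v.
Proof. rewrite /det2; ring. Qed.

Lemma right_of_orient (R : realType) (p q r : R * R) :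
  right_of p q r = (orient p q r < 0).
Proof. by rewrite /right_of /positively_oriented det2_swap oppr_gt0. Qed.

Lemma segment_sym (R : realType) (p q : R * R) : segment p q = segment q p.
Proof.
suff sub (p' q' : R * R) : segment p' q' `<=` segment q' p' by apply/seteqP; split; exact: sub.
move=> x [k /andP[k0 k1] ->]; exists (1 - k); last by rewrite subKr addrC.
by apply/andP; split; lra.
Qed.

Lemma orient_segment (R : realType) (p q r s : R * R) (k : R) :
  orient p q ((1 - k) *: r + k *: s) = (1 - k) * orient p q r + k * orient p q s.
Proof. rewrite /orient /det2 /= /GRing.scale /=; ring. Qed.

(** The affine function [orient p q] vanishes on the first segment and keeps a strict sign on the
    second. *)
Lemma segments_disjoint (R : realType) (p q r s : R * R) :
  0 < orient p q r * orient p q s -> ~ (segment p q `&` segment r s !=set0).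
Proof.
move=> pos [x [[k _ xk] [j /andP[j0 j1] xj]]].
have : orient p q x = 0 by rewrite xk orient_segment /orient /det2 /=; ring.
rewrite {}xj orient_segment; set a := orient p q r in pos *.
set b := orient p q s in pos * => h.
(* Strictness comes from [u] when [j = 0] and from [v] otherwise. *)
have weighted (u v : R) : 0 < u -> 0 < v -> 0 < (1 - j) * u + j * v.
  move=> u0 v0; have [->|jn0] := eqVneq j 0; first by rewrite subr0 mul1r mul0r addr0.
  by rewrite ltr_wpDl ?mulr_ge0 ?mulr_gt0 ?subr_ge0 ?(ltW u0)// lt_def jn0.
have [a0|a0|a0] := ltgtP a 0.
- have b0 : b < 0 by rewrite -(nmulr_rgt0 _ a0).
  have := weighted (- a) (- b); rewrite !mulrN -opprD h oppr0 ltxx !oppr_gt0.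
  by move=> /(_ a0 b0).
- have b0 : 0 < b by rewrite -(pmulr_rgt0 _ a0).
  by have := weighted a b a0 b0; rewrite h ltxx.
- by rewrite a0 mul0r ltxx in pos.
Qed.

(** Each segment has its ends strictly on opposite sides of the line through the other, so the
    crossing point of the two lines lies on both. *)
Lemma segments_meet (R : realType) (p q r s : R * R) :
  orient p q r * orient p q s < 0 -> orient r s p * orient r s q < 0 ->
  segment p q `&` segment r s !=set0.
Proof.
(* An affine function with values [a] and [b] at the ends of a segment vanishes at the parameter
   [a / (a - b)]. *)
have ratio (a b : R) : a * b < 0 -> a - b != 0 /\ 0 <= a / (a - b) <= 1.
  move=> ab; have [a0|a0|a0] := ltgtP a 0.
  - have b0 : 0 < b by rewrite -(nmulr_rlt0 _ a0).
    have d : a - b < 0 by lra.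
    split; first by rewrite lt_eqF.
    by rewrite ler_ndivlMr// ler_ndivrMr// mul0r mul1r; apply/andP; split; lra.
  - have b0 : b < 0 by rewrite -(pmulr_rlt0 _ a0).
    have d : 0 < a - b by lra.
    split; first by rewrite gt_eqF.
    by rewrite ler_pdivlMr// ler_pdivrMr// mul0r mul1r; apply/andP; split; lra.
  - by rewrite a0 mul0r ltxx in ab.
move=> /ratio[d1 j01] /ratio[d2 k01].
set k := orient r s p / _ in k01; set j := orient p q r / _ in j01.
exists ((1 - k) *: p + k *: q); split; first by exists k.
exists j => //; move: d1 d2; rewrite /k /j /orient /det2 /=.
move=> d1 d2; apply: injective_projections; rewrite /= /GRing.scale /=; field;
  by rewrite d1 d2.
Qed.

(** * Points and chords of the half-circle *)

(** The signed area of a triangle inscribed in the unit circle is governed by the sines of half the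
    arcs spanned by its sides. *)
Lemma orient_gauss (R : realType) (a b x : R) :
  orient (gauss_point a) (gauss_point b) (gauss_point x) =
  4 * (sin (pi * (b - a) / 2) * sin (pi * (x - b) / 2) *
       sin (pi * (x - a) / 2)).
Proof.
transitivity (sin (pi * b - pi * a) + sin (pi * x - pi * b)
   - sin (pi * x - pi * a)).
  rewrite /orient /det2 /= !sinB; ring.
set y := pi * (b - a) / 2; set z := pi * (x - b) / 2.
have -> : pi * b - pi * a = y + y by rewrite /y; field.
have -> : pi * x - pi * b = z + z by rewrite /z; field.
have -> : pi * x - pi * a = (y + z) + (y + z) by rewrite /y /z; field.
have -> : pi * (x - a) / 2 = y + z by rewrite /y /z; field.
rewrite !sinD cosD; apply/eqP; rewrite -subr_eq0; apply/eqP.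
(* The two sides differ by multiples of the relations [cos ^+ 2 + sin ^+ 2 = 1] for [y] and [z]. *)
transitivity (2 * sin y * cos y * (1 - (cos z ^+ 2 + sin z ^+ 2)) +
              2 * sin z * cos z * (1 - (cos y ^+ 2 + sin y ^+ 2))); first ring.
by rewrite !cos2Dsin2 subrr !mulr0 addr0.
Qed.

(** All three half arcs lie in []0, pi / 2]], where the sine is positive. *)
Lemma orient_gauss_gt0 (R : realType) (a b x : R) :
  0 <= a -> a < b -> b < x -> x <= 1 ->
  0 < orient (gauss_point a) (gauss_point b) (gauss_point x).
Proof.
move=> a0 ab bx x1.
have pos (d : R) : 0 < d -> d <= 1 -> 0 < sin (pi * d / 2).
  move=> d0 d1; apply: sin_gt0_pi; have := pi_gt0 R => pi0.
  by apply/andP; split; nra.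
by rewrite orient_gauss !mulr_gt0// pos//; lra.
Qed.

Lemma orient_gauss_inside (R : realType) (a b x : R) :
  0 <= a -> a < x < b -> b <= 1 ->
  orient (gauss_point a) (gauss_point b) (gauss_point x) < 0.
Proof.
move=> a0 /andP[ax xb] b1; rewrite orient_rot orient_rot orient_swap oppr_lt0.
exact: orient_gauss_gt0.
Qed.

Lemma orient_gauss_outside (R : realType) (a b x : R) :
  0 <= a -> a < b -> b <= 1 -> 0 <= x <= 1 -> x != a -> x != b ->
  ~~ (a < x < b) ->
  0 < orient (gauss_point a) (gauss_point b) (gauss_point x).
Proof.
move=> a0 ab b1 /andP[x0 x1] xa xb; rewrite negb_and -!leNgt.
rewrite (le_eqVlt x) (le_eqVlt b) (negPf xa) eq_sym (negPf xb) /=.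
case/orP => h; last exact: orient_gauss_gt0.
by rewrite orient_rot orient_rot; exact: orient_gauss_gt0.
Qed.

Lemma orient_gauss_lt0E (R : realType) (a b x : R) :
  0 <= a -> a < b -> b <= 1 -> 0 <= x <= 1 -> x != a -> x != b ->
  (orient (gauss_point a) (gauss_point b) (gauss_point x) < 0) = (a < x < b).
Proof.
move=> a0 ab b1 x01 xa xb; have [xin|xout] := boolP (a < x < b).
  exact: orient_gauss_inside.
by apply: le_gtF; apply/ltW/orient_gauss_outside.
Qed.

Lemma orient_gauss_gt0E (R : realType) (a b x : R) :
  0 <= a -> a < b -> b <= 1 -> 0 <= x <= 1 -> x != a -> x != b ->
  (0 < orient (gauss_point a) (gauss_point b) (gauss_point x)) = ~~ (a < x < b).
Proof.
move=> a0 ab b1 x01 xa xb; have [xin|xout] := boolP (a < x < b).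
  by apply: le_gtF; apply/ltW/orient_gauss_inside.
exact: orient_gauss_outside.
Qed.

(** If [s] and [t] are both inside or both outside []a, b[], one chord stays strictly on one side of
    the other. Otherwise the four ends alternate along the half-circle, so each chord separates the
    ends of the other. *)
Lemma gauss_chords_meet (R : realType) (a b s t : R) :
  0 <= a -> a < b -> b <= 1 -> 0 <= s <= 1 -> 0 <= t <= 1 ->
  s != a -> s != b -> t != a -> t != b ->
  (segment (gauss_point a) (gauss_point b) `&`
     segment (gauss_point s) (gauss_point t) !=set0) <->
  (a < s < b) != (a < t < b).
Proof.
move=> a0 ab b1 s01 t01 sa sb ta tb.
have mixed x y : 0 <= y <= 1 -> y != a -> y != b -> a < x < b ->
    ~~ (a < y < b) ->
    segment (gauss_point a) (gauss_point b) `&`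
     segment (gauss_point x) (gauss_point y) !=set0.
  move=> y01 ya yb xin yout; apply: segments_meet.
    by rewrite nmulr_rlt0 ?orient_gauss_inside// orient_gauss_outside.
  (* It remains to separate [a] from [b] by the chord of [x] and [y]: for [y < a] only [a] lies
     between [y] and [x], for [b < y] only [b] does. *)
  move/andP: xin => [ax xb]; move/andP: (y01) => [y0 y1].
  move: yout; rewrite negb_and -!leNgt.
  rewrite (le_eqVlt y) (le_eqVlt b) (negPf ya) (eq_sym b) (negPf yb) /=.
  case/orP => h.
    rewrite !(orient_swap (gauss_point y) (gauss_point x)) mulrNN nmulr_rlt0.
      by apply: orient_gauss_gt0 => //; lra.
    by apply: orient_gauss_inside => //; [rewrite h ax|lra].
  rewrite pmulr_rlt0; first by apply: orient_gauss_inside => //; [lra|rewrite h xb].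
  by rewrite orient_rot orient_rot; apply: orient_gauss_gt0 => //; lra.
have [sin|sout] := boolP (a < s < b); have [tin|tout] := boolP (a < t < b);
    split => //.
- move=> meet; exfalso; move: meet; apply: segments_disjoint.
  by rewrite nmulr_rgt0 ?orient_gauss_inside.
- by move=> _; exact: mixed.
- by move=> _; rewrite (segment_sym (gauss_point s)); exact: mixed.
- move=> meet; exfalso; move: meet; apply: segments_disjoint.
  by rewrite mulr_gt0// orient_gauss_outside.
Qed.

(** * Closures of connected components *)

(** A separation of [B] has [A] inside one side [E b]; then [B] lies in the closure of [E b], which
    misses the other side. *)
Lemma connected_between (T : topologicalType) (A B : set T) :
  connected A -> A `<=` B -> B `<=` closure A -> connected B.
Proof.
move=> cA AB BA; apply/connectedP => E [E0 BE sE].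
have disj b : closure (E b) `&` E (~~ b) = set0.
  by case: sE => h1 h2; case: b => //=; rewrite setIC.
have AE : exists b, A `<=` E b.
  have [|h|h] := connected_subset sE _ cA; first by rewrite -BE.
    by exists false.
  by exists true.
case: AE => b /closureS AEb; have [x Ex] := E0 (~~ b).
have Bx : B x by rewrite BE; case: (b) Ex => /=; [left|right].
suff : (closure (E b) `&` E (~~ b)) x by rewrite disj.
by split => //; apply/AEb/BA.
Qed.

(** Components of [X] are closed in [X]: adding the limit point [x] to one keeps it connected, so by
    maximality both are the component of [x]. *)
Lemma closure_component_inj (T : topologicalType) (X : set T) (p q x : T) :
  X x -> closure (connected_component X p) x ->
  closure (connected_component X q) x ->
  connected_component X p = connected_component X q.
Proof.
move=> Xx.
have comp r : X r -> closure (connected_component X r) x ->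
    connected_component X r = connected_component X x.
  move=> Xr clx; apply: same_connected_component.
  apply: (@connected_component_max _ _ (connected_component X r `|` [set x])).
  - by left; exact: connected_component_refl.
  - by move=> y [/connected_component_sub//|->].
  - apply: connected_between (@component_connected _ X r) _ _.
      by move=> y; left.
    by move=> y [|->//]; exact: subset_closure.
  - by right.
(* For a base point outside [X] the component is empty by convention, and so is its closure. *)
have [Xp|nXp] := pselect (X p); last by rewrite connected_component_out// closure0.
have [Xq|nXq] := pselect (X q); last by rewrite (connected_component_out nXq) closure0.
by move=> /(comp _ Xp) -> /(comp _ Xq) ->.
Qed.

(** * Crossings and the parameters of their passages *)

Lemma curve_continuous (R : realType) (D : knotoid_diagram R) (t : R) :
  0 <= t <= 1 -> {for t, continuous D}.
Proof.
move=> t01; have [[smooth _] _ _ _ _] := curve_generic D.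
have /nbhs_singleton/(_ 0%N) := smooth t t01.
by move=> /derivable1_diffP; exact: differentiable_continuous.
Qed.

Lemma double_point_over_under (R : realType) (D : knotoid_diagram R) c :
  crossings D c -> double_point D (over_time D c) (under_time D c).
Proof. by move=> /over_under_timeP[]. Qed.

Lemma double_point_sym (R : realType) (D : knotoid_diagram R) s t :
  double_point D s t -> double_point D t s.
Proof. by case=> s01 t01 st e; split => //; rewrite eq_sym. Qed.

Lemma curve_over (R : realType) (D : knotoid_diagram R) c :
  crossings D c -> D (over_time D c) = c.
Proof. by move=> /over_under_timeP[]. Qed.

Lemma curve_under (R : realType) (D : knotoid_diagram R) c :
  crossings D c -> D (under_time D c) = c.
Proof. by move=> cc; have [_ _ _ <-] := double_point_over_under cc; exact: curve_over. Qed.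

(** A [t] other than the overpass forms a double point with it, and the absence of triple points
    makes [t] the underpass. *)
Lemma crossing_time (R : realType) (D : knotoid_diagram R) t :
  0 <= t <= 1 -> crossings D (D t) ->
  t = over_time D (D t) \/ t = under_time D (D t).
Proof.
move=> t01 ct; have dp := double_point_over_under ct.
have [_ _ tri _ _] := curve_generic D.
have [/eqP eq|ne] := boolP (t == over_time D (D t)); first by left.
right.
have [s01 _ _ _] := dp.
by apply: tri dp; split => //; rewrite curve_over.
Qed.

(** The list is not sorted along the curve; order enters only through conditions [a < t < b]. *)
Definition passages (R : realType) (D : knotoid_diagram R) : seq R :=
  [seq over_time D e | e <- fset_set (crossings D)] ++
  [seq under_time D e | e <- fset_set (crossings D)].

Lemma finite_crossings (R : realType) (D : knotoid_diagram R) :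
  finite_set (crossings D).
Proof. by have [_ ? _ _ _] := curve_generic D. Qed.

Lemma mem_crossings (R : realType) (D : knotoid_diagram R) e :
  e \in fset_set (crossings D) -> crossings D e.
Proof. by rewrite in_fset_set; [rewrite inE|exact: finite_crossings]. Qed.

Lemma mem_passages (R : realType) (D : knotoid_diagram R) t :
  0 <= t <= 1 -> crossings D (D t) -> t \in passages D.
Proof.
move=> t01 ct; have cF : D t \in fset_set (crossings D).
  by rewrite in_fset_set ?inE//; exact: finite_crossings.
rewrite mem_cat; apply/orP.
by have [eq|eq] := crossing_time t01 ct; [left|right]; apply/mapP; exists (D t).
Qed.

Lemma passages_crossing (R : realType) (D : knotoid_diagram R) t :
  t \in passages D -> 0 <= t <= 1 /\ crossings D (D t).
Proof.
rewrite mem_cat => /orP[] /mapP[e /mem_crossings ce ->];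
  have [s01 t01 _ _] := double_point_over_under ce.
  by rewrite curve_over.
by rewrite curve_under.
Qed.

Lemma passages_uniq (R : realType) (D : knotoid_diagram R) : uniq (passages D).
Proof.
rewrite cat_uniq !map_inj_in_uniq ?fset_uniq ?andbT /=.
- apply/hasPn => _ /mapP[e /mem_crossings ce ->]; apply/mapP => -[e' /mem_crossings ce' eq].
  have ee' : e = e' by rewrite -(curve_under ce) eq curve_over.
  have [_ _ /eqP + _] := double_point_over_under ce; apply.
  by rewrite eq ee'.
- move=> e e' /mem_crossings ce /mem_crossings ce' eq.
  by rewrite -(curve_under ce) eq curve_under.
- move=> e e' /mem_crossings ce /mem_crossings ce' eq.
  by rewrite -(curve_over ce) eq curve_over.
Qed.

(** * Arcs between consecutive passages *)

(** The image of []a, b[] is connected and avoids the crossings, so it lies in one component. The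
    filter [F] stands for either one-sided limit, which treats incoming and outgoing arcs at
    once. *)
Lemma arc_between (R : realType) (D : knotoid_diagram R) (a b : R)
    (F : set_system R) (FF : ProperFilter F) :
  0 <= a -> a < b -> b <= 1 -> (forall t, t \in passages D -> ~~ (a < t < b)) ->
  (\forall s \near F, a < s < b) ->
  xget set0 [set A | arcs D A /\ \forall s \near F, A (D s)] =
  closure (connected_component (image_curve D `\` crossings D) (D ((a + b) / 2))).
Proof.
move=> a0 ab b1 noT Fab; set X := image_curve D `\` crossings D.
have mem_X s : a < s < b -> X (D s).
  move=> sab; have s01 : 0 <= s <= 1.
    by move/andP: sab => [? ?]; apply/andP; split; lra.
  split; first by exists s.
  by move=> cs; have /negP := noT _ (mem_passages s01 cs).
have mab : a < (a + b) / 2 < b by apply/andP; split; lra.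
have conn : D @` `]a, b[ `<=` connected_component X (D ((a + b) / 2)).
  apply: connected_component_max.
  - by exists ((a + b) / 2) => //; rewrite /= in_itv.
  - by move=> _ [s /= + <-]; rewrite in_itv /=; exact: mem_X.
  - apply: connected_continuous_connected.
      by apply/connected_intervalP; exact: interval_is_interval.
    apply: continuous_in_subspaceT => s; rewrite inE /= in_itv /= => /andP[? ?].
    by apply: curve_continuous; apply/andP; split; lra.
apply: xget_unique.
  split; first by exists (D ((a + b) / 2)) => //; exact: mem_X.
  near=> s; apply: subset_closure; apply: conn; exists s => //.
  by rewrite /= in_itv /=; near: s.
(* Uniqueness: another candidate arc shares with this one a non-crossing point [D s], which
   determines the component. *)
move=> _ [[p Xp ->] nearA].
have [s [sA sab]] := filter_ex (filterI nearA Fab).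
congr closure; apply: closure_component_inj (mem_X s sab) sA _.
by apply: subset_closure; apply: conn; exists s => //; rewrite /= in_itv.
Unshelve. all: by end_near.
Qed.

Lemma incoming_outgoing (R : realType) (D : knotoid_diagram R) (a b : R) :
  0 <= a -> a < b -> b <= 1 -> (forall t, t \in passages D -> ~~ (a < t < b)) ->
  incoming_arc D b = outgoing_arc D a.
Proof.
move=> a0 ab b1 noT; rewrite /incoming_arc /outgoing_arc.
rewrite !(arc_between _ a0 ab b1 noT)//; near=> s.
  by apply/andP; split; near: s; [exact: nbhs_right_gt|exact: nbhs_right_lt].
by apply/andP; split; near: s; [exact: nbhs_left_gt|exact: nbhs_left_lt].
Unshelve. all: by end_near.
Qed.

(** * Telescoping of the labels along the curve *)

(** As [s] is unsorted, the induction is on the number of its elements strictly between [a] and [b],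
    splitting at any one of them. *)
Lemma telescope_seq (R : realType) (V : zmodType) (s : seq R) (before after : R -> V) :
  uniq s ->
  (forall a b, a \in s -> b \in s -> a < b ->
     (forall t, t \in s -> ~~ (a < t < b)) -> before b = after a) ->
  forall a b, a \in s -> b \in s -> a < b ->
  before b - after a = \sum_(t <- s | a < t < b) (after t - before t).
Proof.
move=> us adj a b; move: {2}(count _ s).+1 (ltnSn (count (fun t => a < t < b) s)) => n.
elim: n a b => // n IH a b; rewrite ltnS => cn sa sb ab.
have [/hasP[t st /andP[at_ tb]]|/hasPn none] := boolP (has (fun t => a < t < b) s); last first.
  by rewrite big_seq_cond big_pred0 ?(adj a b) ?subrr// => t; apply/negP => /andP[/none /negP].
(* A subinterval of []a, b[] that omits [t] contains fewer elements of [s], since [t] is counted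
   once in []a, b[]. *)
have smaller (c d : R) : a <= c -> d <= b -> ~~ (c < t < d) ->
    (count (fun u : R => (c < u < d)%R) s < n)%N.
  move=> ac db ntd; apply: leq_trans cn.
  have := count_predUI (fun u : R => (c < u < d)%R) (pred1 t) s.
  rewrite (count_uniq_mem t us) st addn1.
  rewrite (@eq_count _ (predI _ _) pred0) ?count_pred0 ?addn0 => [<-|u /=].
    apply: sub_count => u /= /orP[/andP[cu ud]|/eqP ->]; last by rewrite at_.
    by rewrite (le_lt_trans ac cu) (lt_le_trans ud db).
  by apply/negP => /andP[ctd /eqP ut]; rewrite ut (negPf ntd) in ctd.
have left_sum := IH a t _ sa st at_.
have right_sum := IH t b _ st sb tb.
transitivity ((before t - after a) + (after t - before t) + (before b - after t)).
  by rewrite [RHS]addrC (addrC (before t - _)) !subrKA.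
rewrite left_sum ?smaller ?ltxx ?andbF// 1?ltW// right_sum ?smaller ?ltxx// 1?ltW//.
have -> : after t - before t = \sum_(u <- s | pred1 t u) (after u - before u).
  by rewrite -big_filter filter_pred1_uniq// big_seq1.
(* The sums are compared term by term: []a, b[] is the disjoint union of []a, t[], the point [t] and
   []t, b[]. *)
rewrite [in LHS](big_mkcond (fun u => a < u < t)) (big_mkcond (pred1 t)).
rewrite (big_mkcond (fun u => t < u < b)) (big_mkcond (fun u => a < u < b)).
rewrite -!big_split; apply: eq_bigr => u _ /=.
have [ut|tu|->] := ltgtP u t.
- by rewrite (lt_trans ut tb) andbT /= !addr0.
- by rewrite (lt_trans at_ tu) andbF /= !add0r.
- by rewrite at_ tb andbF /= add0r addr0.
Qed.

Definition jump (R : realType) (D : knotoid_diagram R)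
    (L : set (R * R) -> int) (t : R) : int :=
  L (outgoing_arc D t) - L (incoming_arc D t).

Lemma label_telescope (R : realType) (D : knotoid_diagram R)
    (L : set (R * R) -> int) (a b : R) :
  a \in passages D -> b \in passages D -> a < b ->
  L (incoming_arc D b) - L (outgoing_arc D a) =
  \sum_(t <- passages D | a < t < b) jump D L t.
Proof.
move=> pa pb ab.
apply: (@telescope_seq _ _ _ (L \o incoming_arc D) (L \o outgoing_arc D)) => //.
  exact: passages_uniq.
move=> {pa pb ab}a {}b /passages_crossing[/andP[a0 _] _] /passages_crossing[/andP[_ b1] _] ab h /=.
by rewrite (incoming_outgoing a0 ab b1 h).
Qed.

(** * Label jumps in terms of crossing signs *)

(** Transversality makes the determinant of the tangents nonzero, so the two cases of the coloring
    rule are exhaustive. *)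
Lemma jump_double_point (R : realType) (D : knotoid_diagram R)
    (L : set (R * R) -> int) (s t : R) :
  cheng_coloring D L -> double_point D s t ->
  jump D L t = if right_to_left D s t then 1 else -1.
Proof.
move=> hL dp; have [rl lr] := hL _ _ dp; rewrite /jump.
have [/rl ->|nrl] := boolP (right_to_left D s t); first by rewrite addrC addKr.
rewrite lr; first by rewrite addrC addKr.
have [_ _ _ tr _] := curve_generic D; have := tr _ _ dp.
move: nrl; rewrite /right_to_left /left_to_right /positively_oriented.
by rewrite [det2 (tangent D t) _]det2_swap oppr_gt0 -leNgt le_eqVlt => /orP[/eqP ->|//]; rewrite eqxx.
Qed.

Lemma right_to_left_sym (R : realType) (D : knotoid_diagram R) (s t : R) :
  double_point D s t -> right_to_left D t s = ~~ right_to_left D s t.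
Proof.
have [_ _ _ tr _] := curve_generic D; move=> /tr.
rewrite /right_to_left /positively_oriented (det2_swap (tangent D s)) oppr_gt0.
by rewrite /tangent => ne; rewrite -leNgt le_eqVlt (negPf ne).
Qed.

(** [sgn] tests the same determinant as [right_to_left] for the passage of the understrand. *)
Lemma jump_under (R : realType) (D : knotoid_diagram R)
    (L : set (R * R) -> int) (e : R * R) :
  cheng_coloring D L -> crossings D e -> jump D L (under_time D e) = sgn D e.
Proof. by move=> hL /double_point_over_under /(jump_double_point hL). Qed.

Lemma jump_over (R : realType) (D : knotoid_diagram R)
    (L : set (R * R) -> int) (e : R * R) :
  cheng_coloring D L -> crossings D e -> jump D L (over_time D e) = - sgn D e.
Proof.
move=> hL /double_point_over_under dp.
rewrite (jump_double_point hL (double_point_sym dp)) (right_to_left_sym dp).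
by rewrite /sgn /right_to_left; case: (positively_oriented _ _).
Qed.

(** Zero when both or neither of the passages of [e] fall in []a, b[]; otherwise its sign tells
    which one does. *)
Definition passes_between (R : realType) (D : knotoid_diagram R) (a b : R)
    (e : R * R) : int :=
  (a < under_time D e < b)%R%:Z - (a < over_time D e < b)%R%:Z.

(** Grouping the passages by crossing, the two jumps at [e] are opposite and cancel when both are
    met. *)
Lemma sum_jumps (R : realType) (D : knotoid_diagram R)
    (L : set (R * R) -> int) (a b : R) :
  cheng_coloring D L ->
  \sum_(t <- passages D | a < t < b) jump D L t =
  \sum_(e <- fset_set (crossings D)) sgn D e * passes_between D a b e.
Proof.
move=> hL; rewrite big_cat /= !big_map !(big_mkcond (fun e => a < _ e < b)).
rewrite -big_split /= big_seq [RHS]big_seq; apply: eq_bigr => e /mem_crossings ce.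
rewrite jump_under// jump_over// /passes_between.
by case: (a < under_time D e < b); case: (a < over_time D e < b) => /=; ring.
Qed.

(** * The degree as a sum over all crossings *)

(** Indicators over a common index set let the four cardinals in the degree be added term by
    term. *)
Lemma cardz_sum (R : realType) (X A : set (R * R)) :
  finite_set X -> A `<=` X ->
  cardz A = \sum_(e <- fset_set X) (e \in A)%:Z.
Proof.
move=> fX AX; have fA : finite_set A := sub_finite_set AX fX.
have -> : cardz A = \sum_(e <- fset_set A) 1%:Z.
  by rewrite /cardz card_fset_sum1 -natz natr_sum.
transitivity (\sum_(e <- fset_set X | e \in A) 1%:Z).
  apply: eq_fbigl_cond => e; rewrite !inE /= andbT !in_fset_set//.
  apply/idP/andP => [eA|[]//]; split => //.
  by move: eA; rewrite !inE; exact: AX.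
by rewrite big_mkcond; apply: eq_bigr => e _; case: (e \in A).
Qed.

Lemma mem_of_sign_rset (R : realType) (D : knotoid_diagram R) (i : int) c e :
  crossings D e ->
  (e \in of_sign D i (rset D c)) =
  [&& `[< chords_cross D c e >],
      right_of (chord_tail D c) (chord_head D c) (chord_head D e) & sgn D e == i].
Proof.
move=> ce; apply/idP/idP.
  by rewrite inE => -[[_ cr ->] /= ->]; rewrite eqxx andbT; exact/asboolP.
by move=> /and3P[/asboolP cr ri /eqP sg]; rewrite inE; split.
Qed.

Lemma mem_of_sign_lset (R : realType) (D : knotoid_diagram R) (i : int) c e :
  crossings D e ->
  (e \in of_sign D i (lset D c)) =
  [&& `[< chords_cross D c e >],
      left_of (chord_tail D c) (chord_head D c) (chord_head D e) & sgn D e == i].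
Proof.
move=> ce; apply/idP/idP.
  by rewrite inE => -[[_ cr ->] /= ->]; rewrite eqxx andbT; exact/asboolP.
by move=> /and3P[/asboolP cr le /eqP sg]; rewrite inE; split.
Qed.

(** With the overpass of [c] first, a crossing chord [e] points to the right exactly when its
    underpass is the passage in between, and to the left when its overpass is. With the underpass
    first the sides are exchanged, hence the minus sign. *)
Lemma chord_contribution (R : realType) (D : knotoid_diagram R) (c e : R * R) :
  crossings D c -> crossings D e ->
  (e \in of_sign D 1 (rset D c))%:Z - (e \in of_sign D (-1) (rset D c))%:Z
  - (e \in of_sign D 1 (lset D c))%:Z + (e \in of_sign D (-1) (lset D c))%:Z =
  sgn D e * (if over_time D c < under_time D c
    then passes_between D (over_time D c) (under_time D c) e
    else - passes_between D (under_time D c) (over_time D c) e).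
Proof.
move=> cc ce; rewrite !mem_of_sign_rset// !mem_of_sign_lset//.
(* The chord [c] does not cross itself, and the strict bounds exclude its own ends. *)
have [{ce}->|ec] := eqVneq e c.
  have -> : `[< chords_cross D c c >] = false by apply/asboolP => -[].
  by rewrite /passes_between !ltxx /= !andbF; case: ifP => _; rewrite mulr0.
have [c0 uc01 ouc _] := double_point_over_under cc.
have [e0 ue01 oue _] := double_point_over_under ce.
have distinct s t : D s = e -> D t = c -> s != t.
  by move=> es ct; apply: contraNneq ec => st; rewrite -es -ct st.
have [Doe Due] := (curve_over ce, curve_under ce).
have [Doc Duc] := (curve_over cc, curve_under cc).
have sgn_cases : sgn D e = 1 \/ sgn D e = -1.
  by rewrite /sgn; case: ifP; [left|right].
have crossE : `[< chords_cross D c e >] =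
    `[< chord D c `&` chord D e !=set0 >].
  by apply: asbool_equiv_eq; split => [[]//|]; split => //; exact/eqP.
rewrite crossE right_of_orient /left_of /positively_oriented.
rewrite -/(orient (chord_tail D c) (chord_head D c) (chord_head D e)).
rewrite /chord /chord_tail /chord_head /passes_between.
have [ou|uo|eq] := ltgtP (over_time D c) (under_time D c).
- have [/andP[a0 _] /andP[_ b1]] := (c0, uc01).
  rewrite orient_gauss_lt0E ?distinct// orient_gauss_gt0E ?distinct//.
  rewrite (asbool_equiv_eq (gauss_chords_meet a0 ou b1 e0 ue01 _ _ _ _)) ?distinct//.
  rewrite asboolb.
  by case: (_ < over_time D e < _); case: (_ < under_time D e < _);
    case: sgn_cases => ->.
- have [/andP[a0 _] /andP[_ b1]] := (uc01, c0).
  (* Reversing the chord puts its ends in increasing order of parameter and exchanges its sides. *)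
  rewrite segment_sym orient_swap oppr_lt0 oppr_gt0.
  rewrite orient_gauss_lt0E ?distinct// orient_gauss_gt0E ?distinct//.
  rewrite (asbool_equiv_eq (gauss_chords_meet a0 uo b1 e0 ue01 _ _ _ _)) ?distinct//.
  rewrite asboolb.
  by case: (_ < over_time D e < _); case: (_ < under_time D e < _);
    case: sgn_cases => ->.
- by rewrite eq eqxx in ouc.
Qed.

Lemma degree_sum (R : realType) (D : knotoid_diagram R) (c : R * R) :
  crossings D c ->
  degree D c = \sum_(e <- fset_set (crossings D)) sgn D e *
   (if over_time D c < under_time D c
    then passes_between D (over_time D c) (under_time D c) e
    else - passes_between D (under_time D c) (over_time D c) e).
Proof.
move=> cc; have sub i A : A `<=` crossings D -> of_sign D i A `<=` crossings D.
  by move=> AX e [/AX].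
have rX : rset D c `<=` crossings D by move=> e [].
have lX : lset D c `<=` crossings D by move=> e [].
have fX := @finite_crossings R D.
rewrite /degree !(cardz_sum fX) ?sub//; [|exact: sub..].
rewrite -!sumrB -big_split /= big_seq [RHS]big_seq.
by apply: eq_bigr => e /mem_crossings ce; exact: chord_contribution.
Qed.

Theorem proposition3p1 (R : realType) (D : knotoid_diagram R)
    (L : set (R * R) -> int) (hL : cheng_coloring D L)
    (c : R * R) (hc : crossings D c) :
  coloring_number D L c = degree D c * sgn D c.
Proof.
have [s01 t01 ouc _] := double_point_over_under hc.
have po : over_time D c \in passages D by rewrite mem_passages ?curve_over.
have pu : under_time D c \in passages D by rewrite mem_passages ?curve_under.
have jo := jump_over hL hc; have ju := jump_under hL hc.
rewrite degree_sum//.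
have [ou|uo|eq] := ltgtP (over_time D c) (under_time D c);
  last by rewrite eq eqxx in ouc.
(* For positive sign the telescoped difference is the coloring number itself; for negative sign it
   is its opposite, since the jumps at the two passages of [c] cancel. *)
- rewrite -(sum_jumps _ _ hL) -label_telescope//.
  move: jo ju; rewrite /jump /coloring_number /rl_strand /lr_strand /sgn.
  rewrite /right_to_left; case: ifP => _; lia.
(* Here the degree is minus the telescoped difference, and it is the positive sign that needs the
   jumps at [c]. *)
- under eq_bigr do rewrite mulrN.
  rewrite sumrN -(sum_jumps _ _ hL) -label_telescope//.
  move: jo ju; rewrite /jump /coloring_number /rl_strand /lr_strand /sgn.
  rewrite /right_to_left; case: ifP => _; lia.
Qed.
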